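(* Let $f\in\mathcal{F}$, let $\mathcal{D}$ be a probability distribution on $\Gamma$, and assume $\alpha+3\beta>1$ and the no-explosion assumption (constant $K$). For $\epsilon\in(0,1]$ and $\delta\in(0,1)$ let $$M=\max\left\{\left(\frac{\big(2C_d\|f\|_{\mathcal{F}}(1+\sqrt{2\log\frac1\delta})\big)^2}{\epsilon}\right)^{\frac1{2\alpha+4\beta+1}},\left(\frac{C_d'}{\epsilon}\right)^{\frac1{\alpha+3\beta-1}},\left(\frac{\|f\|_{\mathcal{F}}}{\epsilon}\right)^{\frac1{2\alpha+5\beta-1}},\left(\frac{\|f\|_{\mathcal{F}}^2}{\epsilon}\right)^{\frac1{2\alpha+4\beta}}\right\},$$ with $C_d=2d^{5/2}+4d^2+26d^{3/2}+12d$, $C_d'=4d^{5/2}+12d^2+60d^{3/2}+76d+24d^{1/2}$, and $$T_0=C_f\min\left\{\frac{m^{\frac{1+3\alpha+\beta}2}}{\epsilon^{3/4}},\frac{m^{\frac{1+5\alpha+3\beta}3}}{\epsilon^{2/3}},\frac{m^{\frac{2+4\alpha}3}}{\epsilon^{2/3}},\frac{m^{2\alpha+2\beta}}{\epsilon^{1/2}},\frac{m^{-1+3\alpha+5\beta}}{\epsilon},\frac{m^{\frac{2+5\alpha+2\beta}3}}{\epsilon^{2/3}},\frac{m^{\frac{1+4\alpha+3\beta}2}}{\epsilon^{1/2}},\frac{m^{1+2\alpha+\beta}}{\epsilon^{1/2}}\right\},$$ where $C_f:=\frac{1}{(\|f\|_{\mathcal{F}}+1)^2\max\{\|f\|_{\mathcal{F}},1\}}$.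 Suppose $m\ge M$ and $T_0>\|f\|_{\mathcal{F}}^2/\epsilon^2$. Let the number of iterations satisfy $T\in[\|f\|_{\mathcal{F}}^2/\epsilon^2,T_0]$ and the learning rate satisfy $\eta=\Theta(\epsilon/m)$ (i.e. $c_1\epsilon/m\le\eta\le c_2\epsilon/m$ for fixed constants $0<c_1\le c_2$). Then with probability at least $1-\delta$ over the random initialization, $$\mathbb{E}_X\,\mathbb{E}_{sgd}\left[\frac1T\sum_{t=0}^{T-1}\mathcal{L}_\Psi(X;W_t)\right]\le O(\epsilon),$$ where $\mathbb{E}_X$ is the expectation over the training set $X$ ($N$ i.i.d. samples from $\mathcal{D}$), $\mathbb{E}_{sgd}$ is the expectation over the random choices ${\bm x}^{(t)}\sim\mathcal{U}(X)$ of SGD, and the constant in $O(\epsilon)$ depends only on $d$, $K$, $c_1$, $c_2$ (in particular not on $N$).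
   Context: Fix an integer $d\ge1$ and let $\Gamma=\{{\bm x}\in\mathbb{R}^d:\|{\bm x}\|_2\le1\}$. Fix exponents $\alpha,\beta\ge0$ and a width $m\in\mathbb{N}^+$. Random initialization: for $i=1,\dots,m$, independently, $a_i^{(0)}\sim\mathcal{U}(-m^{-\alpha},m^{-\alpha})$, ${\bm w}_i^{(0)}\in\mathbb{R}^d$ has i.i.d. coordinates $\sim\mathcal{U}(-m^{-\beta},m^{-\beta})$, and $b_i^{(0)}\sim\mathcal{U}(-m^{-\beta},m^{-\beta})$. Let $\Lambda:=[-m^{-\alpha},m^{-\alpha}]\times[-m^{-\beta},m^{-\beta}]^d\times[-m^{-\beta},m^{-\beta}]$, $p(\theta)=|\Lambda|^{-1}\mathbb{I}_{\theta\in\Lambda}$. For $\theta=(a,{\bm w},b)\in\Lambda$, ${\bm x}\in\Gamma$: ${\bm\zeta}({\bm x};\theta)=a\big(2d({\bm w}^\top{\bm x}+b)^2+12({\bm w}^\top{\bm x})({\bm w}^\top{\bm x}+b)+6({\bm w}^\top{\bm w})(\|{\bm x}\|_2^2-1)\big){\bm x}\,\mathbb{I}_{{\bm w}^\top{\bm x}+b\ge0}$. $\mathcal{F}$ is the class of $f:\Gamma\to\mathbb{R}$ with $f({\bm x})=\int_\Lambda{\bm\alpha}(\theta)^\top{\bm\zeta}({\bm x};\theta)\,{\rm d}\theta$ for some ${\bm\alpha}:\Lambda\to\mathbb{R}^d$, normed by $\|f\|_{\mathcal{F}}:=\inf_{{\bm\alpha}}\max_{\theta\in\Lambda}\|{\bm\alpha}(\theta)\|_2/p(\theta)$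 (infimum assumed attained). PINN: for $W=[{\bm w}_1~\dots~{\bm w}_m]$, ${\bm w}_i\in\mathbb{R}^d$ (only the ${\bm w}_i$ are trainable; $a_i^{(0)},b_i^{(0)}$ stay fixed), $$\psi({\bm x};W)=\sum_{i=1}^m a_i^{(0)}\Big(2d({\bm w}_i^\top{\bm x}+b_i^{(0)})^3+12({\bm w}_i^\top{\bm x}+b_i^{(0)})^2({\bm w}_i^\top{\bm x})+6({\bm w}_i^\top{\bm x}+b_i^{(0)})({\bm w}_i^\top{\bm w}_i)(\|{\bm x}\|_2^2-1)\Big)\mathbb{I}_{{\bm w}_i^\top{\bm x}+b_i^{(0)}\ge0}.$$ Loss: $\mathcal{L}(h({\bm x})):=|h({\bm x})-f({\bm x})|^2$. SGD: training set $X=\{{\bm x}_1,\dots,{\bm x}_N\}$ drawn i.i.d. from $\mathcal{D}$; $W^{(0)}=[{\bm w}_1^{(0)}~\dots~{\bm w}_m^{(0)}]$; for $t=1,\dots,T$, pick ${\bm x}^{(t)}$ uniformly from $X$ and set $W^{(t)}=W^{(t-1)}-\eta\nabla_W\mathcal{L}(\psi({\bm x}^{(t)};W^{(t-1)}))$; $W_t:=W^{(t)}-W^{(0)}$, ${\bm w}_i^{(t)}$ the $i$-th column of $W^{(t)}$. Training loss: $\mathcal{L}_\Psi(X;W):=\frac1N\sum_{n=1}^N\mathcal{L}(\psi({\bm x}_n;W^{(0)}+W))$. No-explosion assumption: there is a constant $K\ge1$, independent of $m,\eta,t,T,N$, such that $\|{\bm w}_i^{(t)}\|_2\le K$ and $|\psi({\bm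 x};W^{(t)})|\le K$ for all $i$, all $t\in\{0,\dots,T\}$ and all ${\bm x}\in\Gamma$. *)

(* Defs.v *)
From HB Require Import structures.
From mathcomp Require Import all_boot all_order all_algebra.
From mathcomp Require Import all_classical all_reals all_analysis.
Set Implicit Arguments.
Unset Strict Implicit.
Unset Printing Implicit Defensive.
Import Order.TTheory GRing.Theory Num.Theory.
Local Open Scope classical_set_scope.
Local Open Scope ring_scope.

(* Vectors of R^d are represented as d.-tuples (which carry the        *)
(* product sigma-algebra of mathcomp-analysis).                        *)

Definition vdot (R : realType) (d : nat) (x y : d.-tuple R) : R :=
  \sum_(i < d) tnth x i * tnth y i.

Definition vnorm (R : realType) (d : nat) (x : d.-tuple R) : R :=
  Num.sqrt (vdot x x).

Definition vlin (R : realType) (d : nat) (c1 : R) (x : d.-tuple R)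
  (c2 : R) (y : d.-tuple R) : d.-tuple R :=
  [tuple c1 * tnth x i + c2 * tnth y i | i < d].

Definition ind (R : realType) (P : bool) : R := if P then 1 else 0.

Definition Gamma (R : realType) (d : nat) : set (d.-tuple R) :=
  [set x | vnorm x <= 1].

Definition psi_unit (R : realType) (d : nat) (a : R) (w : d.-tuple R) (b : R)
  (x : d.-tuple R) : R :=
  let z := vdot w x + b in
  let u := vdot w x in
  a * (2 * d%:R * z ^+ 3 + 12 * z ^+ 2 * u
       + 6 * z * vdot w w * (vdot x x - 1)) * ind R (0 <= z).

Definition psi (R : realType) (d m : nat) (a b : m.-tuple R)
  (W : m.-tuple (d.-tuple R)) (x : d.-tuple R) : R :=
  \sum_(i < m) psi_unit (tnth a i) (tnth W i) (tnth b i) x.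

(* gradient of psi_unit w.r.t. w (indicator treated as a constant, the
   usual (sub)gradient convention for ReLU-type activations):
   a 1_{z>=0} [ (6d z^2 + 12 z^2 + 24 z (w.x) + 6 (w.w)(|x|^2-1)) x
                + 12 (|x|^2-1) z w ] *)
Definition grad_unit (R : realType) (d : nat) (a : R) (w : d.-tuple R) (b : R)
  (x : d.-tuple R) : d.-tuple R :=
  let z := vdot w x + b in
  let u := vdot w x in
  let c := vdot x x - 1 in
  [tuple a * ind R (0 <= z) *
     ((6 * d%:R * z ^+ 2 + 12 * z ^+ 2 + 24 * z * u + 6 * vdot w w * c)
        * tnth x j + 12 * c * z * tnth w j) | j < d].

(* one SGD step on the loss |psi(x;W) - f(x)|^2 at sample x:
   w_i <- w_i - eta * 2 (psi(x;W) - f(x)) * grad_{w_i} psi(x;W) *)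
Definition sgd_step (R : realType) (d m : nat) (f : d.-tuple R -> R) (eta : R)
  (a b : m.-tuple R) (W : m.-tuple (d.-tuple R)) (x : d.-tuple R)
  : m.-tuple (d.-tuple R) :=
  [tuple vlin 1 (tnth W i) (- (eta * 2 * (psi a b W x - f x)))
           (grad_unit (tnth a i) (tnth W i) (tnth b i) x) | i < m].

(* SGD trajectory W^(t), t = 0, 1, ...; the sample used at step t (t >= 1)
   is x^(t) = X_{s(t-1)}, where s : {ffun 'I_T -> 'I_N} records the random
   choices of SGD. *)
Fixpoint sgd_iter (R : realType) (d m N T : nat) (f : d.-tuple R -> R) (eta : R)
  (a b : m.-tuple R) (W0 : m.-tuple (d.-tuple R)) (X : N.-tuple (d.-tuple R))
  (s : {ffun 'I_T -> 'I_N}) (t : nat) : m.-tuple (d.-tuple R) :=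
  match t with
  | 0 => W0
  | t'.+1 =>
      let W := sgd_iter f eta a b W0 X s t' in
      match @insub nat (fun k => k < T)%N 'I_T t' with
      | Some i => sgd_step f eta a b W (tnth X (s i))
      | None => W
      end
  end.

(* training loss L_Psi(X; W_t) = (1/N) sum_n |psi(x_n; W^(0) + W_t) - f(x_n)|^2,
   written with W^(t) = W^(0) + W_t *)
Definition train_loss (R : realType) (d m N : nat) (f : d.-tuple R -> R)
  (a b : m.-tuple R) (X : N.-tuple (d.-tuple R)) (W : m.-tuple (d.-tuple R)) : R :=
  (N%:R)^-1 * \sum_(n < N) (psi a b W (tnth X n) - f (tnth X n)) ^+ 2.

(* E_sgd [ (1/T) sum_{t=0}^{T-1} L_Psi(X; W_t) ]: the T choices are i.i.d.
   uniform on {1..N}, i.e. s is uniform on the N^T functions 'I_T -> 'I_N *)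
Definition sgd_expected_avg_loss (R : realType) (d m N T : nat)
  (f : d.-tuple R -> R) (eta : R) (a b : m.-tuple R)
  (W0 : m.-tuple (d.-tuple R)) (X : N.-tuple (d.-tuple R)) : R :=
  ((N%:R) ^+ T)^-1 *
  \sum_(s : {ffun 'I_T -> 'I_N})
     ((T%:R)^-1 * \sum_(t < T) train_loss f a b X (sgd_iter f eta a b W0 X s t)).

(* prodE E1 n g = E_{(x_1,...,x_n) i.i.d. ~ E1} [g(x_1,...,x_n)], written as
   the iterated integral (equal to the product-measure integral by
   Fubini-Tonelli for the nonnegative / integrable integrands used here). *)
Fixpoint prodE (R : realType) (T : Type) (E1 : (T -> \bar R) -> \bar R) (n : nat)
  : (n.-tuple T -> \bar R) -> \bar R :=
  match n return (n.-tuple T -> \bar R) -> \bar R with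
  | 0 => fun g => g [tuple]
  | n'.+1 => fun g => E1 (fun x => @prodE R T E1 n' (fun t => g (cons_tuple x t)))
  end.
Arguments prodE {R T} E1 n g.

Definition lebE (R : realType) (r : R) (h : R -> \bar R) : \bar R :=
  (\int[@lebesgue_measure R]_(x in `[(- r)%R, r]) h x)%E.

Definition unifE (R : realType) (r : R) (h : R -> \bar R) : \bar R :=
  (((2 * r)^-1)%:E * lebE r h)%E.

Definition lawE (R : realType) (d : nat) (D : probability (d.-tuple R) R)
  (h : d.-tuple R -> \bar R) : \bar R :=
  (\int[D]_x h x)%E.

Definition initProb (R : realType) (d m : nat) (al be : R)
  (E : m.-tuple R -> m.-tuple (d.-tuple R) -> m.-tuple R -> Prop) : \bar R :=
  prodE (unifE ((m%:R : R) `^ (- al))) m (fun a =>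
  prodE (prodE (unifE ((m%:R : R) `^ (- be))) d) m (fun W =>
  prodE (unifE ((m%:R : R) `^ (- be))) m (fun b =>
    (ind R `[< E a W b >])%:E))).

Definition init_support (R : realType) (d m : nat) (al be : R)
  (a : m.-tuple R) (W : m.-tuple (d.-tuple R)) (b : m.-tuple R) : Prop :=
  (forall i, `|tnth a i| <= (m%:R : R) `^ (- al)) /\
  (forall i j, `|tnth (tnth W i) j| <= (m%:R : R) `^ (- be)) /\
  (forall i, `|tnth b i| <= (m%:R : R) `^ (- be)).

Definition inLambda (R : realType) (d m : nat) (al be : R)
  (a : R) (w : d.-tuple R) (b : R) : Prop :=
  `|a| <= (m%:R : R) `^ (- al) /\
  (forall j, `|tnth w j| <= (m%:R : R) `^ (- be)) /\
  `|b| <= (m%:R : R) `^ (- be).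

Definition volLambda (R : realType) (d m : nat) (al be : R) : R :=
  (2 * (m%:R : R) `^ (- al)) * (2 * (m%:R : R) `^ (- be)) ^+ d.+1.

Definition pdens (R : realType) (d m : nat) (al be : R)
  (a : R) (w : d.-tuple R) (b : R) : R :=
  (volLambda d m al be)^-1 * ind R `[< inLambda m al be a w b >].

Definition zeta (R : realType) (d : nat) (a : R) (w : d.-tuple R) (b : R)
  (x : d.-tuple R) : d.-tuple R :=
  let z := vdot w x + b in
  let u := vdot w x in
  [tuple a * (2 * d%:R * z ^+ 2 + 12 * u * z + 6 * vdot w w * (vdot x x - 1))
       * tnth x j * ind R (0 <= z) | j < d].

Definition intLambda (R : realType) (d m : nat) (al be : R)
  (g : R -> d.-tuple R -> R -> R) : \bar R :=
  lebE ((m%:R : R) `^ (- al)) (fun a =>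
  prodE (lebE ((m%:R : R) `^ (- be))) d (fun w =>
  lebE ((m%:R : R) `^ (- be)) (fun b => (g a w b)%:E))).

Definition represents (R : realType) (d m : nat) (al be : R)
  (f : d.-tuple R -> R) (A : R -> d.-tuple R -> R -> d.-tuple R) : Prop :=
  (forall j : 'I_d,
     measurable_fun [set: R * d.-tuple R * R]
       (fun th : R * d.-tuple R * R => tnth (A th.1.1 th.1.2 th.2) j)) /\
  (forall x, Gamma x ->
     (f x)%:E = intLambda m al be (fun a w b => vdot (A a w b) (zeta a w b x))).

Definition normF (R : realType) (d m : nat) (al be : R) (f : d.-tuple R -> R) : R :=
  inf [set B : R | exists A, represents m al be f A /\
         forall a w b, inLambda m al be a w b ->
           vnorm (A a w b) / pdens m al be a w b <= B].

Definition inF_attained (R : realType) (d m : nat) (al be : R)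
  (f : d.-tuple R -> R) : Prop :=
  exists A, represents m al be f A /\
    forall a w b, inLambda m al be a w b ->
      vnorm (A a w b) / pdens m al be a w b <= normF m al be f.

Definition Cd (R : realType) (d : nat) : R :=
  let D : R := d%:R in
  2 * D `^ (5/2) + 4 * D ^+ 2 + 26 * D `^ (3/2) + 12 * D.

Definition Cd' (R : realType) (d : nat) : R :=
  let D : R := d%:R in
  4 * D `^ (5/2) + 12 * D ^+ 2 + 60 * D `^ (3/2) + 76 * D + 24 * D `^ (1/2).

Definition Mbound (R : realType) (d : nat) (al be nf eps delta : R) : R :=
  Num.max
   (Num.max
     (((2 * Cd R d * nf * (1 + Num.sqrt (2 * ln (delta^-1)))) ^+ 2 / eps)
        `^ ((2 * al + 4 * be + 1)^-1))
     ((Cd' R d / eps) `^ ((al + 3 * be - 1)^-1)))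
   (Num.max
     ((nf / eps) `^ ((2 * al + 5 * be - 1)^-1))
     ((nf ^+ 2 / eps) `^ ((2 * al + 4 * be)^-1))).

Definition Cf (R : realType) (nf : R) : R :=
  ((nf + 1) ^+ 2 * Num.max nf 1)^-1.

Definition T0bound (R : realType) (m : nat) (al be nf eps : R) : R :=
  let M : R := m%:R in
  Cf nf *
  Num.min
   (Num.min
     (Num.min (M `^ ((1 + 3 * al + be) / 2) / eps `^ (3/4))
              (M `^ ((1 + 5 * al + 3 * be) / 3) / eps `^ (2/3)))
     (Num.min (M `^ ((2 + 4 * al) / 3) / eps `^ (2/3))
              (M `^ (2 * al + 2 * be) / eps `^ (1/2))))
   (Num.min
     (Num.min (M `^ (-1 + 3 * al + 5 * be) / eps)
              (M `^ ((2 + 5 * al + 2 * be) / 3) / eps `^ (2/3)))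
     (Num.min (M `^ ((1 + 4 * al + 3 * be) / 2) / eps `^ (1/2))
              (M `^ (1 + 2 * al + be) / eps `^ (1/2)))).

Definition no_explosion (R : realType) (d m N T : nat) (al be : R)
  (f : d.-tuple R -> R) (eta K : R) : Prop :=
  forall (a b : m.-tuple R) (W0 : m.-tuple (d.-tuple R)),
    init_support al be a W0 b ->
  forall (X : N.-tuple (d.-tuple R)), (forall n, Gamma (tnth X n)) ->
  forall (s : {ffun 'I_T -> 'I_N}) (t : nat), (t <= T)%N ->
    (forall i, vnorm (tnth (sgd_iter f eta a b W0 X s t) i) <= K) /\
    (forall x, Gamma x -> `|psi a b (sgd_iter f eta a b W0 X s t) x| <= K).

(* Main.v *)
(* The hypotheses on m and T force the trivial regime, so no regret analysis
   and no concentration inequality is needed. Write A = m^-al, B = m^-be.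
   The integral representation gives |f| <= C nf A B^2 on Gamma, and the fourth
   term of M makes (nf A B^2)^2 <= eps. By the no-explosion assumption, every
   SGD step moves each coordinate of each w_i by at most sigma (eps / m) A, so
   after T steps the drift is at most r = T sigma (eps / m) A. A unit is cubic
   in (w, b), so |psi| <= C m A (B + r)^3 <= 4 C (m A B^3 + m A r^3), where
   m A B^3 <= eps by the second term of M and m A r^3 <= sigma^3 eps by the
   third term of T0. Hence |psi - f|^2 = O(eps) along every trajectory, for
   every initialization in the support and every sample in Gamma; the event
   has probability one.

   The integrands in f and in E_X are not known to be measurable, so integrals
   are bounded directly from their definition as suprema over simple functions.
*)
Require Import Defs.
From HB Require Import structures.
From mathcomp Require Import all_boot all_order all_algebra.
From mathcomp Require Import all_classical all_reals all_analysis.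
From mathcomp Require Import measurable_realfun ring lra.
Import Order.TTheory GRing.Theory Num.Theory.
Local Open Scope classical_set_scope.
Local Open Scope ring_scope.

(** * Integrals and iterated expectations of possibly non-measurable functions *)

Section nonneg_simple.
Import HBNNSimple.

(** The integral is a supremum over nonnegative simple functions below [h] extended by 0 off [D].
    Each of these is measurable and a.e. at most [B] on [D], so ordinary monotonicity applies to
    it. *)
Lemma ge0_integral_ae_bound {dT : measure_display} {T : measurableType dT}
    {R : realType} (mu : {measure set T -> \bar R}) (D : set T)
    (h : T -> \bar R) (B : R) :
  measurable D -> 0 <= B -> (forall x, D x -> 0 <= h x)%E ->
  (\forall x \ae mu, D x -> (h x <= B%:E)%E) ->
  (\int[mu]_(x in D) h x <= B%:E * mu D)%E.
Proof.
move=> mD B0 h0 hB; rewrite ge0_integralE//.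
apply: ge_ereal_sup => _ [k kh <-].
have -> : sintegral mu k = (\int[mu]_x (k x)%:E)%E.
  by rewrite integral_nnsfun// patch_setT.
rewrite -integral_cst//= [leRHS]integral_mkcond.
apply: ae_ge0_le_integral => //.
- by move=> x _; rewrite lee_fin fun_ge0.
- by apply/measurable_EFinP; exact: measurable_funTS.
- by move=> x _; apply: erestrict_ge0.
- by apply/(measurable_restrictT _ _).1 => //; exact: measurable_cst.
- apply: filterS hB => x hx _; have := kh x; rewrite /patch.
  by case: ifPn => // /set_mem Dx kx; exact: le_trans kx (hx Dx).
Qed.

End nonneg_simple.

(** Positive and negative parts both integrate into [[0, c * B]], and a difference of two such
    numbers stays within [c * B], without a factor 2. *)
Lemma integral_ae_bound {dT : measure_display} {T : measurableType dT}
    {R : realType} (mu : {measure set T -> \bar R}) (D : set T)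
    (h : T -> \bar R) (B c : R) :
  measurable D -> 0 <= B -> mu D = c%:E ->
  (\forall x \ae mu, D x -> (`|h x| <= B%:E)%E) ->
  (`|\int[mu]_(x in D) h x| <= (c * B)%:E)%E.
Proof.
move=> mD B0 muD hB; rewrite integralE.
have pB : (\int[mu]_(x in D) h^\+ x <= (c * B)%:E)%E.
  rewrite mulrC EFinM -muD; apply: ge0_integral_ae_bound => //.
  apply: filterS hB => x hx /hx hB; rewrite funeposE ge_max lee_fin B0 andbT.
  by rewrite (le_trans _ hB)// lee_abs.
have nB : (\int[mu]_(x in D) h^\- x <= (c * B)%:E)%E.
  rewrite mulrC EFinM -muD; apply: ge0_integral_ae_bound => //.
  apply: filterS hB => x hx /hx hB; rewrite funenegE ge_max lee_fin B0 andbT.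
  by rewrite (le_trans _ hB)// -abseN lee_abs.
have p0 : (0 <= \int[mu]_(x in D) h^\+ x)%E by apply: integral_ge0.
have n0 : (0 <= \int[mu]_(x in D) h^\- x)%E by apply: integral_ge0.
move: pB nB p0 n0.
case: (integral mu D h^\+%E) => [p| |]//; case: (integral mu D h^\-%E) => [n| |]//.
by rewrite -EFinB abse_EFin !lee_fin ler_norml => *; apply/andP; split; lra.
Qed.

(** Here [c] stands for the total mass of one factor and [P] for its support. Each layer of the
    iterated integral contributes one factor [c]. *)
Lemma prodE_bound {R : realType} {T : Type} (E1 : (T -> \bar R) -> \bar R)
    (P : T -> Prop) (c : R) :
  0 <= c ->
  (forall h B, 0 <= B -> (forall x, P x -> (`|h x| <= B%:E)%E) ->
     (`|E1 h| <= (c * B)%:E)%E) ->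
  forall n g B, 0 <= B ->
    (forall t : n.-tuple T, (forall i, P (tnth t i)) -> (`|g t| <= B%:E)%E) ->
    (`|prodE E1 n g| <= (c ^+ n * B)%:E)%E.
Proof.
move=> c0 E1B; elim=> [|n IH] g B B0 gB /=.
  by rewrite expr0 mul1r; apply: gB => -[].
rewrite exprS -mulrA; apply: E1B => [|x Px]; first by rewrite mulr_ge0// exprn_ge0.
apply: IH => // t Pt; apply: gB => i.
by case: (unliftP ord0 i) => [j ->|->]; rewrite ?tnthS ?tnth0.
Qed.

(** A lower bound on a probability cannot come from [prodE_bound], so an integrand constant on the
    support is evaluated exactly. *)
Lemma prodE_cst {R : realType} {T : Type} (E1 : (T -> \bar R) -> \bar R)
    (P : T -> Prop) (k : \bar R) :
  (forall h, (forall x, P x -> h x = k) -> E1 h = k) ->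
  forall n g, (forall t : n.-tuple T, (forall i, P (tnth t i)) -> g t = k) ->
    prodE E1 n g = k.
Proof.
move=> E1k; elim=> [|n IH] g gk /=; first by apply: gk => -[].
apply: E1k => x Px; apply: IH => t Pt; apply: gk => i.
by case: (unliftP ord0 i) => [j ->|->]; rewrite ?tnthS ?tnth0.
Qed.

Lemma lebesgue_measure_sym_itv {R : realType} (r : R) : 0 <= r ->
  @lebesgue_measure R `[- r, r] = (2 * r)%:E.
Proof.
move=> r0; rewrite lebesgue_measure_itv/= lte_fin.
case: ltP => [_|rr]; first by rewrite -EFinB; congr (_%:E); ring.
have -> : r = 0 by lra.
by rewrite mulr0.
Qed.

Lemma lebE_bound {R : realType} (r : R) (h : R -> \bar R) (B : R) :
  0 <= r -> 0 <= B -> (forall x, `|x| <= r -> (`|h x| <= B%:E)%E) ->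
  (`|lebE r h| <= (2 * r * B)%:E)%E.
Proof.
move=> r0 B0 hB; apply: integral_ae_bound => //.
  exact: lebesgue_measure_sym_itv.
by apply: aeW => x /=; rewrite in_itv/= -ler_norml; exact: hB.
Qed.

Lemma unifE_cst {R : realType} (r : R) (k : R) (h : R -> \bar R) :
  0 < r -> (forall x, `|x| <= r -> h x = k%:E) -> unifE r h = k%:E.
Proof.
move=> r0 hk; rewrite /unifE /lebE (eq_integral (cst k%:E)); last first.
  by move=> x; rewrite inE/= in_itv/= -ler_norml; exact: hk.
rewrite integral_cst//= lebesgue_measure_sym_itv ?ltW// -!EFinM.
by congr (_%:E); field; lra.
Qed.

(** The indicator of [E] is constantly 1 on the support; [0 < m] keeps the radii positive, so every
    uniform average has mass one. *)
Lemma initProb_support {R : realType} {d m : nat} (al be : R)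
    (E : m.-tuple R -> m.-tuple (d.-tuple R) -> m.-tuple R -> Prop) :
  (0 < m)%N -> (forall a W b, init_support al be a W b -> E a W b) ->
  initProb al be E = 1%E.
Proof.
move=> m0 EW; have M0 (x : R) : 0 < (m%:R : R) `^ x by rewrite powR_gt0 ?ltr0n.
pose P (x r : R) := `|r| <= m%:R `^ x.
have H x h : (forall r, P x r -> h r = 1%E) -> unifE (m%:R `^ x) h = 1%E.
  exact: unifE_cst.
apply: (@prodE_cst _ _ _ (P (- al)) _ (H (- al))) => a Pa.
apply: (@prodE_cst _ _ _ (fun w : d.-tuple R => forall j, P (- be) (tnth w j)))
  => [h hw|W PW].
  exact: (@prodE_cst _ _ _ (P (- be)) _ (H (- be))).
apply: (@prodE_cst _ _ _ (P (- be)) _ (H (- be))) => b Pb.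
by rewrite /ind asboolT//; exact: EW.
Qed.

(** * Euclidean norm, the unit ball, and expectation over the training set *)

Lemma vnorm2 {R : realType} {d : nat} (x : d.-tuple R) :
  vnorm x ^+ 2 = vdot x x.
Proof.
by rewrite sqr_sqrtr// sumr_ge0// => i _; rewrite -expr2 sqr_ge0.
Qed.

Lemma vnorm_ge0 {R : realType} {d : nat} (x : d.-tuple R) : 0 <= vnorm x.
Proof. exact: sqrtr_ge0. Qed.

Lemma tnth_le_vnorm {R : realType} {d : nat} (x : d.-tuple R) i :
  `|tnth x i| <= vnorm x.
Proof.
rewrite -(ler_pXn2r (n := 2)) ?nnegrE ?vnorm_ge0//.
rewrite vnorm2 real_normK ?num_real// /vdot (bigD1 i)//= -expr2 lerDl.
by apply: sumr_ge0 => j _; rewrite -expr2 sqr_ge0.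
Qed.

Lemma vdot_bound {R : realType} {d : nat} {x y : d.-tuple R} {r s : R} :
  (forall i, `|tnth x i| <= r) -> (forall i, `|tnth y i| <= s) ->
  `|vdot x y| <= d%:R * (r * s).
Proof.
move=> xr ys; apply: le_trans (ler_norm_sum _ _ _) _.
rewrite -[d in leRHS]card_ord mulr_natl -sumr_const; apply: ler_sum => i _.
by rewrite normrM ler_pM.
Qed.

Lemma measurable_Gamma {R : realType} (d : nat) : measurable (@Gamma R d).
Proof.
have -> : @Gamma R d = (fun x => vdot x x) @^-1` `]-oo, 1%R].
  apply/seteqP; split => x /=; rewrite /Gamma/= in_itv/= -vnorm2 => vx.
    by rewrite exprn_ile1 ?vnorm_ge0.
  by rewrite -(ler_pXn2r (n := 2)) ?nnegrE ?vnorm_ge0// expr1n.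
rewrite -[X in measurable X]setTI; apply: measurable_sum => // i.
by apply: measurable_funM; exact: measurable_tnth.
Qed.

(** Each sample has mass [c = 1], so [prodE_bound] gives a factor [1 ^+ N] and the bound does not
    grow with [N]. *)
Lemma prodE_lawE_bound {R : realType} {d N : nat}
    (D : probability (d.-tuple R) R) (g : N.-tuple (d.-tuple R) -> R) (B : R) :
  D (@Gamma R d) = 1%E -> 0 <= B ->
  (forall X : N.-tuple (d.-tuple R), (forall n, Gamma (tnth X n)) -> `|g X| <= B) ->
  (prodE (lawE D) N (fun X => (g X)%:E) <= B%:E)%E.
Proof.
move=> DG B0 gB; apply: le_trans (lee_abs _) _.
rewrite -[B]mul1r -(expr1n R N).
apply: (@prodE_bound R _ _ (@Gamma R d)) => // h B' B'0 hB.
apply: integral_ae_bound => //; first exact: probability_setT.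
(* The exceptional null set is the complement of the ball, since [D] charges only [Gamma]. *)
exists (~` @Gamma R d); split => [||x /= nx Gx].
- by apply: measurableC; exact: measurable_Gamma.
- apply: eq_trans (probability_setC D (measurable_Gamma d)) _.
  by rewrite DG subee.
- by apply: nx => _; exact: hB.
Qed.

(** * Pointwise bounds on one unit, its gradient and its feature [zeta] *)

Lemma normrM_le {R : realType} {x y a b : R} :
  `|x| <= a -> `|y| <= b -> `|x * y| <= a * b.
Proof. by move=> xa yb; rewrite normrM ler_pM. Qed.

Lemma normrD_le {R : realType} {x y a b : R} :
  `|x| <= a -> `|y| <= b -> `|x + y| <= a + b.
Proof. by move=> xa yb; rewrite (le_trans (ler_normD _ _))// lerD. Qed.

Lemma normrX_le {R : realType} {x a : R} {n} : `|x| <= a -> `|x ^+ n| <= a ^+ n.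
Proof.
by move=> xa; rewrite normrX lerXn2r// nnegrE ?(le_trans _ xa).
Qed.

Lemma normr_nat_le {R : realType} n : `|n%:R : R| <= n%:R.
Proof. by rewrite ger0_norm. Qed.

Lemma ind_le1 {R : realType} p : `|ind R p| <= 1.
Proof. by case: p; rewrite /ind ?normr1// normr0. Qed.

Lemma expr_ge1_le {R : realType} {x : R} {k n : nat} :
  (k <= n)%N -> 1 <= x -> x ^+ k <= x ^+ n.
Proof. by move=> kn x1; rewrite ler_weXn2l. Qed.

Section unit_bounds.
Variables (R : realType) (d : nat) (al rho : R).
Variables (a b : R) (w x : d.-tuple R).
Hypotheses (d1 : (1 <= d)%N) (Gx : Gamma x) (a_le : `|a| <= al).
Hypotheses (w_le : forall j, `|tnth w j| <= rho) (b_le : `|b| <= rho).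

Let D : R := d%:R.
Let z := vdot w x + b.
Let u := vdot w x.

Let D1 : 1 <= D. Proof. by rewrite ler1n. Qed.

Let rho0 : 0 <= rho. Proof. exact: le_trans (normr_ge0 _) b_le. Qed.

Let al0 : 0 <= al. Proof. exact: le_trans (normr_ge0 _) a_le. Qed.

Let x_le j : `|tnth x j| <= 1.
Proof. exact: le_trans (tnth_le_vnorm x j) (Gx : vnorm x <= 1). Qed.

Let u_le : `|u| <= D * rho.
Proof. by have := vdot_bound w_le x_le; rewrite mulr1. Qed.

Let z_le : `|z| <= 2 * D * rho.
Proof.
apply: le_trans (normrD_le u_le b_le) _.
by have := ler_wpM2r rho0 D1; nra.
Qed.

Let q_le : `|vdot w w| <= D * (rho * rho).
Proof. exact: vdot_bound. Qed.

Let c_le : `|vdot x x - 1| <= 1.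
Proof.
have := vnorm2 x; have := vnorm_ge0 x; have : vnorm x <= 1 := Gx.
by move: (vnorm x) => v v1 v0 <-; rewrite ler_norml; apply/andP; split; nra.
Qed.

(** The unit is cubic in [(w, b)], and [rho] bounds both. The constant is 76 = 16 + 48 + 12, after
    raising lower powers of [D >= 1] to [D ^+ 4]. In the same way 150 = 24 + 96 + 30 for the
    gradient and 38 = 8 + 24 + 6 for [zeta]. *)
Lemma psi_unit_bound : `|psi_unit a w b x| <= al * (76 * D ^+ 4 * rho ^+ 3).
Proof.
rewrite /psi_unit -/z -/u -[leRHS]mulr1.
apply: normrM_le; last exact: ind_le1.
apply: normrM_le => //.
(* The middle term copies the polynomial with [z], [u], [vdot w w] and [vdot x x - 1] replaced by
   their bounds, so the proof follows its syntax. *)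
apply: (@le_trans _ _
  (2 * D * (2 * D * rho) ^+ 3 + 12 * (2 * D * rho) ^+ 2 * (D * rho)
   + 6 * (2 * D * rho) * (D * (rho * rho)) * 1)).
  by do ?[exact: normr_nat_le|assumption|apply: normrX_le|apply: normrM_le|
          apply: normrD_le].
have -> : 2 * D * (2 * D * rho) ^+ 3 + 12 * (2 * D * rho) ^+ 2 * (D * rho)
   + 6 * (2 * D * rho) * (D * (rho * rho)) * 1
   = (16 * D ^+ 4 + 48 * D ^+ 3 + 12 * D ^+ 2) * rho ^+ 3 by ring.
apply: ler_wpM2r; first exact: exprn_ge0.
by have := expr_ge1_le (n := 4) (k := 3) isT D1;
   have := expr_ge1_le (n := 4) (k := 2) isT D1; lra.
Qed.

Lemma grad_unit_bound j :
  `|tnth (grad_unit a w b x) j| <= al * (150 * D ^+ 3 * rho ^+ 2).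
Proof.
rewrite tnth_mktuple -/z -/u.
apply: normrM_le; first by rewrite -[leRHS]mulr1 normrM_le// ind_le1.
apply: (@le_trans _ _
  ((6 * D * (2 * D * rho) ^+ 2 + 12 * (2 * D * rho) ^+ 2
    + 24 * (2 * D * rho) * (D * rho) + 6 * (D * (rho * rho)) * 1) * 1
   + 12 * 1 * (2 * D * rho) * rho)).
  by do ?[exact: normr_nat_le|assumption|exact: x_le|exact: w_le|
          apply: normrX_le|apply: normrM_le|apply: normrD_le].
have -> : (6 * D * (2 * D * rho) ^+ 2 + 12 * (2 * D * rho) ^+ 2
    + 24 * (2 * D * rho) * (D * rho) + 6 * (D * (rho * rho)) * 1) * 1
   + 12 * 1 * (2 * D * rho) * rho
   = (24 * D ^+ 3 + 96 * D ^+ 2 + 30 * D) * rho ^+ 2 by ring.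
apply: ler_wpM2r; first exact: exprn_ge0.
by have := expr_ge1_le (n := 3) (k := 2) isT D1;
   have := expr_ge1_le (n := 3) (k := 1) isT D1; lra.
Qed.

Lemma zeta_bound j : `|tnth (zeta a w b x) j| <= al * (38 * D ^+ 3 * rho ^+ 2).
Proof.
rewrite tnth_mktuple -/z -/u -[leRHS]mulr1.
apply: normrM_le; last exact: ind_le1.
rewrite -[leRHS]mulr1; apply: normrM_le; last exact: x_le.
apply: normrM_le => //.
apply: (@le_trans _ _ (2 * D * (2 * D * rho) ^+ 2 + 12 * (D * rho) * (2 * D * rho)
    + 6 * (D * (rho * rho)) * 1)).
  by do ?[exact: normr_nat_le|assumption|
          apply: normrX_le|apply: normrM_le|apply: normrD_le].
have -> : 2 * D * (2 * D * rho) ^+ 2 + 12 * (D * rho) * (2 * D * rho)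
    + 6 * (D * (rho * rho)) * 1
   = (8 * D ^+ 3 + 24 * D ^+ 2 + 6 * D) * rho ^+ 2 by ring.
apply: ler_wpM2r; first exact: exprn_ge0.
by have := expr_ge1_le (n := 3) (k := 2) isT D1;
   have := expr_ge1_le (n := 3) (k := 1) isT D1; lra.
Qed.

End unit_bounds.

Lemma psi_bound {R : realType} {d m : nat} {al rho : R} {a b : m.-tuple R}
    {W : m.-tuple (d.-tuple R)} {x : d.-tuple R} :
  (1 <= d)%N -> Gamma x -> (forall i, `|tnth a i| <= al) ->
  (forall i j, `|tnth (tnth W i) j| <= rho) -> (forall i, `|tnth b i| <= rho) ->
  `|psi a b W x| <= m%:R * (al * (76 * d%:R ^+ 4 * rho ^+ 3)).
Proof.
move=> d1 Gx aal Wr br; apply: le_trans (ler_norm_sum _ _ _) _.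
rewrite -[m in leRHS]card_ord mulr_natl -sumr_const; apply: ler_sum => i _.
exact: psi_unit_bound.
Qed.

(** * Size of the target function *)

Section function_class.
Variables (R : realType) (d m : nat) (al be : R) (f : d.-tuple R -> R).
Hypotheses (m1 : (1 <= m)%N) (fF : inF_attained m al be f).

Let r_al_gt0 : 0 < (m%:R : R) `^ (- al). Proof. by rewrite powR_gt0 ?ltr0n. Qed.
Let r_be_gt0 : 0 < (m%:R : R) `^ (- be). Proof. by rewrite powR_gt0 ?ltr0n. Qed.

Lemma volLambda_gt0 : 0 < volLambda d m al be.
Proof. by rewrite mulr_gt0// ?exprn_gt0// mulr_gt0. Qed.

Lemma pdens_inLambda a (w : d.-tuple R) b : inLambda m al be a w b ->
  pdens m al be a w b = (volLambda d m al be)^-1.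
Proof. by move=> L; rewrite /pdens /ind asboolT// mulr1. Qed.

Lemma normF_ge0 : 0 <= normF m al be f.
Proof.
have [A [_ Ale]] := fF.
(* Attainment makes [normF] dominate the nonnegative ratio at the origin of Lambda. *)
have L0 : inLambda m al be 0 (nseq_tuple d 0) 0.
  by split; [|split => [j|]]; rewrite ?tnth_nseq normr0 ltW.
apply: le_trans (Ale _ _ _ L0); rewrite divr_ge0 ?vnorm_ge0//.
by rewrite pdens_inLambda// invr_ge0 ltW ?volLambda_gt0.
Qed.

(** On Lambda the density [A] has norm at most [nf / v], with [v] the volume. Integrating over
    Lambda cancels [v] and leaves [nf] times the size of [zeta]; the fourth factor [d] comes from
    the dot product. *)
Lemma inF_bound x : (1 <= d)%N -> Gamma x ->
  `|f x| <= 38 * d%:R ^+ 4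
            * (normF m al be f * (m%:R `^ (- al) * (m%:R `^ (- be)) ^+ 2)).
Proof.
move=> d1 Gx; have [A [[_ fE] Ale]] := fF.
set nf := normF _ _ _ _; set ra := m%:R `^ (- al); set rb := m%:R `^ (- be).
have nf0 : 0 <= nf := normF_ge0.
pose v := volLambda d m al be.
have v0 : 0 < v := volLambda_gt0.
pose G := d%:R * ((nf / v) * (ra * (38 * d%:R ^+ 3 * rb ^+ 2))).
have ra0 : 0 <= ra by exact: ltW.
have rb0 : 0 <= rb by exact: ltW.
have G0 : 0 <= G.
  by rewrite /G; do ?[apply: mulr_ge0|apply: exprn_ge0] => //; rewrite invr_ge0 ltW.
have gG a w b : `|a| <= ra -> (forall j, `|tnth w j| <= rb) -> `|b| <= rb ->
    (`|(vdot (A a w b) (zeta a w b x))%:E| <= G%:E)%E.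
  move=> ha hw hb; rewrite abse_EFin lee_fin; apply: vdot_bound => j.
    apply: le_trans (tnth_le_vnorm _ _) _.
    have L : inLambda m al be a w b by [].
    by have := Ale _ _ _ L; rewrite pdens_inLambda// invrK ler_pdivlMr.
  exact: zeta_bound.
rewrite -lee_fin -abse_EFin fE//.
have -> : 38 * d%:R ^+ 4 * (nf * (ra * rb ^+ 2))
    = 2 * ra * ((2 * rb) ^+ d * (2 * rb * G)).
  rewrite /G /v /volLambda -/ra -/rb [(2 * rb) ^+ d.+1]exprS.
  have rd0 : (2 * rb) ^+ d != 0 by rewrite expf_neq0// mulf_neq0// gt_eqF.
  move: ((2 * rb) ^+ d) rd0 => Q Q0.
  by field; rewrite Q0 !gt_eqF.
have rb2 : 0 <= 2 * rb by rewrite mulr_ge0.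
apply: lebE_bound => [||a ha] //.
  exact: mulr_ge0 (exprn_ge0 _ rb2) (mulr_ge0 rb2 G0).
apply: (@prodE_bound _ _ (lebE rb) (fun r => `|r| <= rb)) => //.
- by move=> h B; exact: lebE_bound.
- exact: mulr_ge0.
- by move=> w hw; apply: lebE_bound => // b hb; exact: gG.
Qed.

End function_class.

(** * Drift of the SGD iterates and averaging of the loss *)

Lemma sgd_iter_drift {R : realType} {d m N T : nat} {f : d.-tuple R -> R}
    {eta S : R} {a b : m.-tuple R} {W0 : m.-tuple (d.-tuple R)}
    {X : N.-tuple (d.-tuple R)} {s : {ffun 'I_T -> 'I_N}} :
  let W := sgd_iter f eta a b W0 X s in
  (forall (t : 'I_T) n i j,
     `|eta * 2 * (psi a b (W t) (tnth X n) - f (tnth X n))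
       * tnth (grad_unit (tnth a i) (tnth (W t) i) (tnth b i) (tnth X n)) j| <= S) ->
  forall t, (t <= T)%N -> forall i j,
    `|tnth (tnth (W t) i) j - tnth (tnth W0 i) j| <= t%:R * S.
Proof.
move=> W stepS; elim=> [_|t IH tT] i j; first by rewrite subrr normr0 mul0r.
(* As [t < T], the default branch of [sgd_iter] is excluded and a genuine step is taken. *)
rewrite /W/=; case: insubP => [k _ kt|]; last by rewrite tT.
rewrite /sgd_step tnth_mktuple /vlin tnth_mktuple mul1r mulNr addrAC -[t.+1%:R]natr1 mulrDl mul1r.
apply: normrD_le; first by apply: IH; exact: ltnW.
by rewrite normrN -kt; exact: stepS.
Qed.

Lemma mean_bound {R : realType} {I : finType} {F : I -> R} {B : R} :
  0 <= B -> (forall i, `|F i| <= B) -> `|(#|I|%:R)^-1 * \sum_i F i| <= B.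
Proof.
(* Over an empty index type the mean is 0, because the inverse of 0 is 0; this covers [T = 0]. *)
move=> B0 FB; have [I0|I0] := posnP #|I|.
  by rewrite I0 invr0 mul0r normr0.
have I0' : 0 < #|I|%:R :> R by rewrite ltr0n.
rewrite normrM ger0_norm ?invr_ge0// mulrC ler_pdivrMr//.
apply: le_trans (ler_norm_sum _ _ _) _.
by rewrite mulr_natr -sumr_const; apply: ler_sum => i _; exact: FB.
Qed.

Lemma sgd_expected_avg_loss_bound {R : realType} {d m N T : nat}
    {f : d.-tuple R -> R} {eta : R} {a b : m.-tuple R}
    {W0 : m.-tuple (d.-tuple R)} {X : N.-tuple (d.-tuple R)} {B : R} :
  0 <= B ->
  (forall (s : {ffun 'I_T -> 'I_N}) (t : 'I_T) n,
     (psi a b (sgd_iter f eta a b W0 X s t) (tnth X n) - f (tnth X n)) ^+ 2 <= B) ->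
  `|sgd_expected_avg_loss T f eta a b W0 X| <= B.
Proof.
move=> B0 lossB; rewrite /sgd_expected_avg_loss -natrX.
(* [N ^ T] becomes the cardinal of the set of choice functions, so [mean_bound] applies to all three
   nested averages. *)
rewrite -[X in (X ^ _)%N]card_ord -[X in (_ ^ X)%N]card_ord -card_ffun.
apply: mean_bound => // s; rewrite -[T in T%:R]card_ord.
apply: mean_bound => // t; rewrite /train_loss -[N in N%:R]card_ord.
by apply: mean_bound => // n; rewrite ger0_norm ?sqr_ge0.
Qed.

(** * Consequences of the conditions on [m] and [T] *)

Lemma powR_inv_le {R : realType} {x M p : R} :
  0 < p -> 0 <= x -> 0 <= M -> x `^ p^-1 <= M -> x <= M `^ p.
Proof.
move=> p0 x0 M0 /(ge0_ler_powR (ltW p0)); rewrite -powRrM mulVf ?gt_eqF// powRr1//.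
by apply; rewrite nnegrE// powR_ge0.
Qed.

(** Allows [Cd'] to be dropped from the second term of [Mbound]; the summand [76 * D] alone
    suffices. *)
Lemma Cd'_ge1 {R : realType} {d : nat} : (1 <= d)%N -> 1 <= Cd' R d.
Proof.
move=> d1; have D1 : 1 <= d%:R :> R by rewrite ler1n.
rewrite /Cd'; have := powR_ge0 (d%:R : R); have := expr_ge1_le (k := 1) (n := 2) isT D1.
by move=> h P; have := P (5/2); have := P (3/2); have := P (1/2); lra.
Qed.

Lemma powR_exprn {R : realType} (x r : R) n : (x `^ r) ^+ n = x `^ (r * n%:R).
Proof. by rewrite powRrM powR_mulrn// powR_ge0. Qed.

Lemma Cf_le1 {R : realType} {nf : R} : 0 <= nf -> Cf nf <= 1.
Proof.
move=> nf0; have mx1 : 1 <= Num.max nf 1 by rewrite le_max lexx orbT.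
have h : 1 <= (nf + 1) ^+ 2 * Num.max nf 1.
  by rewrite -[leLHS]mulr1 ler_pM// exprn_ege1// lerDr.
by rewrite /Cf invf_le1// (lt_le_trans _ h).
Qed.

Section scales.
Variables (R : realType) (d m : nat) (al be nf eps delta : R).
Hypotheses (d1 : (1 <= d)%N) (m1 : (1 <= m)%N) (al0 : 0 <= al) (be0 : 0 <= be).
Hypotheses (ab : 1 < al + 3 * be) (nf0 : 0 <= nf) (eps0 : 0 < eps).

Let M : R := m%:R.
Let A := M `^ (- al).
Let B := M `^ (- be).

Let M0 : 0 < M. Proof. by rewrite ltr0n. Qed.

Let MD r s : M `^ (r + s) = M `^ r * M `^ s.
Proof. by apply: powRD; rewrite (gt_eqF M0) implybT. Qed.

Lemma Mbound_init : Mbound d al be nf eps delta <= M -> M * (A * B ^+ 3) <= eps.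
Proof.
rewrite /Mbound !ge_max => /andP[/andP[_ h] _].
have p0 : 0 < al + 3 * be - 1 by rewrite subr_gt0.
have C1 := @Cd'_ge1 R d d1.
have x0 : 0 <= Cd' R d / eps by rewrite divr_ge0 ?(le_trans _ C1)// ltW.
have := powR_inv_le p0 x0 (ltW M0) h; rewrite ler_pdivrMr// => {}h.
have -> : M * (A * B ^+ 3) = (M `^ (al + 3 * be - 1))^-1.
  rewrite /A /B powR_exprn -powRN -[X in X * _]powRr1 ?ltW// -!MD.
  by congr (_ `^ _); ring.
by rewrite -[leLHS]mul1r ler_pdivrMr ?powR_gt0// mulrC (le_trans C1).
Qed.

Lemma Mbound_target :
  Mbound d al be nf eps delta <= M -> (nf * (A * B ^+ 2)) ^+ 2 <= eps.
Proof.
rewrite /Mbound !ge_max => /andP[_ /andP[_ h]].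
(* [1 < al + 3 * be] prevents the two nonnegative exponents from vanishing together. *)
have p0 : 0 < 2 * al + 4 * be by move: al0 be0 ab; generalize al be => p q; lra.
have x0 : 0 <= nf ^+ 2 / eps by rewrite divr_ge0 ?exprn_ge0// ltW.
have := powR_inv_le p0 x0 (ltW M0) h; rewrite ler_pdivrMr// => {}h.
have -> : (nf * (A * B ^+ 2)) ^+ 2 = nf ^+ 2 / M `^ (2 * al + 4 * be).
  rewrite exprMn exprMn /A /B !powR_exprn -powRN -!MD.
  by congr (_ * _ `^ _); ring.
by rewrite ler_pdivrMr ?powR_gt0// mulrC.
Qed.

Lemma T0bound_le :
  T0bound m al be nf eps <= M `^ ((2 + 4 * al) / 3) / eps `^ (2 / 3).
Proof.
set x := (X in _ <= X).
have x0 : 0 <= x by rewrite divr_ge0 ?powR_ge0.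
have Cf0 : 0 <= Cf nf.
  by rewrite invr_ge0 mulr_ge0 ?exprn_ge0 ?addr_ge0// le_max nf0.
apply: (@le_trans _ _ (Cf nf * x)); last by rewrite ler_piMl// Cf_le1.
by apply: ler_wpM2l => //; rewrite !ge_min lexx !orbT.
Qed.

(** Cubing the third bound in [T0bound] clears the fractional powers:
    [T ^+ 3 * eps ^+ 2 * A ^+ 4 <= M ^+ 2]. Multiplying by [eps / M ^+ 2] gives the claim. *)
Lemma T0bound_drift (T : R) : 0 <= T -> T <= T0bound m al be nf eps ->
  M * (A * (T * (eps / M * A)) ^+ 3) <= eps.
Proof.
move=> T0 /le_trans/(_ T0bound_le); rewrite ler_pdivlMr ?powR_gt0// => h.
have {h} : (T * eps `^ (2 / 3)) ^+ 3 <= (M `^ ((2 + 4 * al) / 3)) ^+ 3.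
  by apply: lerXn2r => //; rewrite nnegrE ?mulr_ge0 ?powR_ge0.
have -> : (M `^ ((2 + 4 * al) / 3)) ^+ 3 = M ^+ 2 / A ^+ 4.
  rewrite /A !powR_exprn -powRN -[M ^+ 2]powR_mulrn ?ltW// -MD.
  by congr (_ `^ _); field.
have -> : (T * eps `^ (2 / 3)) ^+ 3 = T ^+ 3 * eps ^+ 2.
  rewrite exprMn; congr (_ * _).
  rewrite powR_exprn -[RHS]powR_mulrn ?ltW//.
  by congr (_ `^ _); field.
have A0 : 0 < A by rewrite powR_gt0.
rewrite ler_pdivlMr ?exprn_gt0// => h.
have -> : M * (A * (T * (eps / M * A)) ^+ 3)
    = eps * (T ^+ 3 * eps ^+ 2 * A ^+ 4) / M ^+ 2.
  by field; rewrite gt_eqF.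
by rewrite ler_pdivrMr ?exprn_gt0// ler_wpM2l// ltW.
Qed.

End scales.

(** * The loss along a trajectory, and the conclusion *)

Lemma exprD3_le {R : realType} {x y : R} : 0 <= x -> 0 <= y ->
  (x + y) ^+ 3 <= 4 * (x ^+ 3 + y ^+ 3).
Proof.
move=> x0 y0; rewrite -subr_ge0.
have -> : 4 * (x ^+ 3 + y ^+ 3) - (x + y) ^+ 3 = 3 * (x + y) * (x - y) ^+ 2 by ring.
apply: mulr_ge0; last exact: sqr_ge0.
by apply: mulr_ge0 => //; exact: addr_ge0.
Qed.

(** In [sigma], [c2] comes from [eta], 2 from differentiating the square, [K + F] bounds the
    residual, and the last factor is the gradient bound at [rho = K]. In [P], 304 = 4 * 76 with 4
    from [exprD3_le]. *)
Lemma sgd_loss_bound {R : realType} {d m N T : nat} {K c2 al be eps eta : R}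
    {f : d.-tuple R -> R} {a b : m.-tuple R} {W0 : m.-tuple (d.-tuple R)}
    {X : N.-tuple (d.-tuple R)} {s : {ffun 'I_T -> 'I_N}} (t : 'I_T) n :
  let D : R := d%:R in
  let M : R := m%:R in
  let A := M `^ (- al) in
  let B := M `^ (- be) in
  let y := normF m al be f * (A * B ^+ 2) in
  let W := sgd_iter f eta a b W0 X s in
  let F := 38 * D ^+ 4 in
  let sigma := c2 * 2 * (K + F) * (150 * D ^+ 3 * K ^+ 2) in
  let P := 304 * D ^+ 4 * (1 + sigma ^+ 3) in
  (1 <= d)%N -> (1 <= m)%N -> 0 <= be -> 1 <= K -> 0 <= c2 -> 0 < eps <= 1 ->
  0 <= eta <= c2 * eps / M ->
  inF_attained m al be f ->
  init_support al be a W0 b -> (forall n, Gamma (tnth X n)) ->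
  no_explosion m N T al be f eta K ->
  M * (A * B ^+ 3) <= eps -> y ^+ 2 <= eps ->
  M * (A * (T%:R * (eps / M * A)) ^+ 3) <= eps ->
  (psi a b (W t) (tnth X n) - f (tnth X n)) ^+ 2 <= 2 * (P ^+ 2 + F ^+ 2) * eps.
Proof.
move=> D M A B y W F sigma P.
move=> d1 m1 be0 K1 c20 /andP[eps0 eps1] /andP[eta0 etaM] fF init GX noexp init_le y_le
  drift_le.
have [aA [wB bB]] := init.
have M1 : 1 <= M by rewrite ler1n.
have M0 : 0 < M by lra.
have D0 : 0 <= D by rewrite ler0n.
have A0 : 0 <= A by exact: powR_ge0.
have B0 : 0 <= B by exact: powR_ge0.
have B1 : B <= 1 by rewrite /B -[leRHS](powRr0 M) ler_powR// oppr_le0.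
have y0 : 0 <= y by rewrite !mulr_ge0 ?exprn_ge0// normF_ge0.
(* From [y ^+ 2 <= eps <= 1]; this gives [F] as a bound on the target in the residual. *)
have y1 : y <= 1 by nra.
have F0 : 0 <= F by rewrite mulr_ge0 ?exprn_ge0.
have fy x : Gamma x -> `|f x| <= F * y by move=> Gx; exact: inF_bound.
have K0 : 0 <= K by lra.
have sigma0 : 0 <= sigma.
  by rewrite /sigma; do ?[apply: mulr_ge0|apply: exprn_ge0|apply: addr_ge0].
pose S := sigma * (eps / M * A).
have e0 : 0 <= eps / M by rewrite divr_ge0// ltW.
have S0 : 0 <= S := mulr_ge0 sigma0 (mulr_ge0 e0 A0).
have step (u : 'I_T) k i j :
    `|eta * 2 * (psi a b (W u) (tnth X k) - f (tnth X k))
      * tnth (grad_unit (tnth a i) (tnth (W u) i) (tnth b i) (tnth X k)) j| <= S.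
  have [wK psiK] := noexp a b W0 init X GX s u (ltnW (ltn_ord u)).
  have -> : S = c2 * eps / M * 2 * (K + F) * (A * (150 * D ^+ 3 * K ^+ 2)).
    by rewrite /S /sigma; ring.
  apply: normrM_le; last first.
    apply: grad_unit_bound => // [l|]; first exact: le_trans (tnth_le_vnorm _ _) (wK i).
    by apply: le_trans (bB i) _; exact: le_trans B1 K1.
  apply: normrM_le; first by apply: normrM_le; rewrite ger0_norm.
  apply: normrD_le; first exact: psiK.
  by rewrite normrN (le_trans (fy _ (GX k)))// ler_piMr.
(* All [T] steps are counted, so one radius serves every time [t]. *)
pose r := T%:R * S.
have r0 : 0 <= r by apply: mulr_ge0.
have w_le i j : `|tnth (tnth (W t) i) j| <= B + r.
  rewrite -[tnth (tnth (W t) i) j](subrK (tnth (tnth W0 i) j)) addrC.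
  apply: normrD_le; first exact: wB.
  apply: le_trans (sgd_iter_drift step _ (ltnW (ltn_ord t)) i j) _.
  by rewrite ler_wpM2r// ler_nat ltnW.
have b_le i : `|tnth b i| <= B + r by rewrite (le_trans (bB i))// lerDl.
have psi_le : `|psi a b (W t) (tnth X n)| <= P * eps.
  apply: le_trans (psi_bound d1 (GX n) aA w_le b_le) _.
  have r3 : M * (A * r ^+ 3) <= sigma ^+ 3 * eps.
    have -> : M * (A * r ^+ 3)
        = sigma ^+ 3 * (M * (A * (T%:R * (eps / M * A)) ^+ 3)).
      by rewrite /r /S; ring.
    by rewrite ler_wpM2l// exprn_ge0.
  apply: (@le_trans _ _ (M * (A * (76 * D ^+ 4 * (4 * (B ^+ 3 + r ^+ 3)))))).
    do 3![apply: ler_wpM2l; rewrite ?mulr_ge0 ?exprn_ge0//; try exact: ltW].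
    exact: exprD3_le.
  have -> : M * (A * (76 * D ^+ 4 * (4 * (B ^+ 3 + r ^+ 3))))
      = 304 * D ^+ 4 * (M * (A * B ^+ 3) + M * (A * r ^+ 3)) by ring.
  have -> : P * eps = 304 * D ^+ 4 * (eps + sigma ^+ 3 * eps) by rewrite /P; ring.
  by rewrite ler_wpM2l ?mulr_ge0 ?exprn_ge0// lerD.
have Pe0 : 0 <= P * eps := le_trans (normr_ge0 _) psi_le.
have Fy0 : 0 <= F * y by exact: mulr_ge0.
have : `|psi a b (W t) (tnth X n) - f (tnth X n)| <= P * eps + F * y.
  by apply: normrD_le => //; rewrite normrN fy.
move/(normrX_le (n := 2)); rewrite ger0_norm ?sqr_ge0// => /le_trans; apply.
(* The square of the sum is at most twice the sum of squares ([h3]), and both [eps ^+ 2] and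
   [y ^+ 2] are at most [eps]. *)
have e2 : eps ^+ 2 <= eps by nra.
have h1 : P ^+ 2 * eps ^+ 2 <= P ^+ 2 * eps by rewrite ler_wpM2l// sqr_ge0.
have h2 : F ^+ 2 * y ^+ 2 <= F ^+ 2 * eps by rewrite ler_wpM2l// sqr_ge0.
have h3 : 0 <= (P * eps - F * y) ^+ 2 by exact: sqr_ge0.
by nra.
Qed.

Theorem theorem3p4 (R : realType) (d : nat) (K c1 c2 : R) :
  (1 <= d)%N -> 1 <= K -> 0 < c1 -> c1 <= c2 ->
  exists C : R, 0 < C /\
  forall (al be : R) (m : nat) (f : d.-tuple R -> R)
         (D : probability (d.-tuple R) R) (eps delta eta : R) (N T : nat),
    (1 <= m)%N -> 0 <= al -> 0 <= be -> 1 < al + 3 * be ->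
    inF_attained m al be f ->
    D (@Gamma R d) = 1%E ->
    0 < eps <= 1 -> 0 < delta < 1 -> (1 <= N)%N ->
    Mbound d al be (normF m al be f) eps delta <= m%:R ->
    normF m al be f ^+ 2 / eps ^+ 2 < T0bound m al be (normF m al be f) eps ->
    normF m al be f ^+ 2 / eps ^+ 2 <= T%:R <= T0bound m al be (normF m al be f) eps ->
    c1 * eps / m%:R <= eta <= c2 * eps / m%:R ->
    no_explosion m N T al be f eta K ->
    ((1 - delta)%:E <=
     @initProb R d m al be (fun a W0 b =>
       (prodE (lawE D) N (fun X =>
          (sgd_expected_avg_loss T f eta a b W0 X)%:E)
        <= (C * eps)%:E)%E))%E.
Proof.
move=> d1 K1 c10 c12.
have c20 : 0 <= c2 by lra.
(* These constants involve only [d], [K] and [c2], so they can be fixed before [al], [be], [m] and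
   the data. *)
pose F : R := 38 * d%:R ^+ 4.
pose sigma := c2 * 2 * (K + F) * (150 * d%:R ^+ 3 * K ^+ 2).
pose P := 304 * d%:R ^+ 4 * (1 + sigma ^+ 3).
have F0 : 0 < F by rewrite mulr_gt0// exprn_gt0// ltr0n.
have C0 : 0 < 2 * (P ^+ 2 + F ^+ 2).
  by rewrite mulr_gt0// ltr_wpDl ?sqr_ge0// exprn_gt0.
exists (2 * (P ^+ 2 + F ^+ 2)); split=> // al be m f D eps delta eta N T m1 al0 be0 ab fF
  DG eps01 /andP[delta0 _] _ Mle _ /andP[_ T_le] /andP[eta_ge eta_le] noexp.
have /andP[eps0 eps1] := eps01.
(* The event has probability 1, which leaves [1 - delta <= 1] and the loss bound on the support. *)
rewrite initProb_support//; first by rewrite lee_fin; lra.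
move=> a W0 b init.
have Ceps0 : 0 <= 2 * (P ^+ 2 + F ^+ 2) * eps by rewrite mulr_ge0// ltW.
apply: prodE_lawE_bound => // X GX.
apply: sgd_expected_avg_loss_bound => // s t n.
have nf0 : 0 <= normF m al be f by exact: normF_ge0.
apply: (@sgd_loss_bound _ _ _ _ _ K c2 al be) => //.
- apply/andP; split=> //; apply: le_trans eta_ge.
  by rewrite divr_ge0// mulr_ge0// ltW.
- exact: Mbound_init Mle.
- exact: Mbound_target Mle.
- exact: T0bound_drift T_le.
Qed.
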